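(* There exists a network $\mathcal{N}$ which has a $2$-dimensional VLNC solution over some finite field and a $3$-dimensional VLNC solution over some finite field, but has no $5$-dimensional VLNC solution over any finite field.
   Context: A network is a finite directed acyclic multigraph whose nodes are partitioned into sources (no incoming edges), terminals (no outgoing edges) and intermediate nodes; each terminal demands the messages of a specified set of sources. For a positive integer $d$ and a finite field $F$, a $d$-dimensional vector linear network code (VLNC) over $F$ works as follows: each source $s$ generates a message $x_s\in F^d$ (messages of different sources are independent and arbitrary); each edge $e$ carries a vector $y_e\in F^d$, where $y_e=Ax_s$ for some $d\times d$ matrix $A$ over $F$ if the tail of $e$ is a source $s$, and $y_e=\sum_{e'} A_{e',e}y_{e'}$ (sum over edges $e'$ entering the tail of $e$, with $d\times d$ matrices $A_{e',e}$ over $F$) if the tail of $e$ is an intermediate node; each terminal $t$ computes vectors of the form $\sum_{e} B_e y_e$ (sum over edges $e$ entering $t$, with fixed $d\times d$ matrices $B_e$). The code is a $d$-dimensional VLNC solution over $F$ if for all choices of source messages every terminal computes each of its demanded messages. *)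

(* Defs.v *)
From HB Require Import structures.
From mathcomp Require Import all_boot all_order all_algebra all_field.
Set Implicit Arguments. Unset Strict Implicit. Unset Printing Implicit Defensive.
Import GRing.Theory.
Local Open Scope ring_scope.

(* A network: nodes 'I_nn, edges 'I_ne (parallel edges allowed),
   each edge e goes from tail e to head e; demand t s = terminal t demands
   the message of source s. *)
Record network := Network {
  nn : nat;
  ne : nat;
  tail : 'I_ne -> 'I_nn;
  head : 'I_ne -> 'I_nn;
  demand : 'I_nn -> 'I_nn -> bool }.

Definition is_source (N : network) (v : 'I_(nn N)) : bool :=
  [forall e : 'I_(ne N), head e != v].
Definition is_terminal (N : network) (v : 'I_(nn N)) : bool :=
  [forall e : 'I_(ne N), tail e != v].
Arguments is_source : clear implicits.
Arguments is_terminal : clear implicits.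

(* well-formedness: acyclic (a topological ranking exists), the three node
   classes form a partition (no node is both source and terminal), and
   demands relate terminals to sources. *)
Definition network_wf (N : network) : Prop :=
  [/\ (exists rk : 'I_(nn N) -> nat, forall e, (rk (tail e) < rk (head e))%N),
      (forall v, ~~ (is_source N v && is_terminal N v)) &
      (forall t s, @demand N t s -> is_terminal N t && is_source N s)].

Definition edge_eqs (N : network) (F : fieldType) (d : nat)
    (Asrc : 'I_(ne N) -> 'M[F]_d) (K : 'I_(ne N) -> 'I_(ne N) -> 'M[F]_d)
    (x : 'I_(nn N) -> 'cV[F]_d) (y : 'I_(ne N) -> 'cV[F]_d) : Prop :=
  forall e : 'I_(ne N),
    if is_source N (tail e) then y e = Asrc e *m x (tail e)
    else y e = \sum_(e' : 'I_(ne N) | head e' == tail e) K e' e *m y e'.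

Definition vlnc_solvable (N : network) (F : fieldType) (d : nat) : Prop :=
  exists (Asrc : 'I_(ne N) -> 'M[F]_d)
         (K : 'I_(ne N) -> 'I_(ne N) -> 'M[F]_d)
         (Dec : 'I_(nn N) -> 'I_(nn N) -> 'I_(ne N) -> 'M[F]_d),
    forall (x : 'I_(nn N) -> 'cV[F]_d) (y : 'I_(ne N) -> 'cV[F]_d),
      edge_eqs Asrc K x y ->
      forall t s, @demand N t s ->
        \sum_(e : 'I_(ne N) | head e == t) Dec t s e *m y e = x s.

(* Main.v *)
(** A circuit on three sources a, b, c is solvable over F in dimension d > 0 exactly
    when d = 0 and 5 <> 0 in F: dimensions 2 and 3 work over F_2 and F_3, while in
    dimension 5 the two conditions contradict each other.

    Up to invertible matrices, the decoders force the coded messages to be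
      Sbc = b + c,    Sab = a + b,    Sac = a + c,    Dac = a - c,
      X1 = a + X b,   Y1 = b + Y c,   X2 = a - X c,   Y2 = b + Y a,
      Z1 = a - XY c,  Z2 = b + YX c,  P = a + b + c,
      U1 = a + 2b + c,  U2 = a + b + 2c,  U3 = 2a + b.
    As P is computed from Z1 and Z2 alone, YX - XY = 1, and taking traces gives d = 0
    in F; conversely multiplication by t and d/dt on F[t]/(t^d) satisfy this relation
    when d = 0 in F. The vectors U1, U2, U3 have determinant 5, so decoding a
    from them forces 5 <> 0. *)

Require Import Defs.
From HB Require Import structures.
From mathcomp Require Import all_boot all_order all_algebra all_field.
From mathcomp Require Import ring.
Set Implicit Arguments. Unset Strict Implicit. Unset Printing Implicit Defensive.
Import GRing.Theory.
Local Open Scope ring_scope.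

(** * Networks from circuits *)

Section CircuitNetwork.

Variables (M : finType) (inp : M -> seq M) (dem : rel M).

(* Message [i] is carried by a bottleneck edge from the node [inl i] to the node [inr i];
   every input [j] of [i] contributes a link from [inr j] to [inl i]. *)
Definition cvertex := (M + M)%type.
Definition cedge := (M + {i : M & 'I_(size (inp i))})%type.

Definition clink (i : M) (k : 'I_(size (inp i))) : cedge :=
  inr (existT (fun i => 'I_(size (inp i))) i k).

Definition wire (i : M) (k : 'I_(size (inp i))) : M := nth i (inp i) k.

Definition ctail (e : cedge) : cvertex :=
  match e with inl i => inl i | inr p => inr (wire (tagged p)) end.
Definition chead (e : cedge) : cvertex :=
  match e with inl i => inr i | inr p => inl (tag p) end.
Definition cdemand (t s : cvertex) : bool :=
  if t is inr t' then if s is inl s' then dem t' s' else false else false.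

Definition circuit_network : network :=
  @Network #|{: cvertex}| #|{: cedge}|
    (fun e => enum_rank (ctail (enum_val e)))
    (fun e => enum_rank (chead (enum_val e)))
    (fun t s => cdemand (enum_val t) (enum_val s)).

Local Notation N := circuit_network.

(** The [m] columns of [V] are independent runs of the code: [m = 1] carries messages, and [m = d]
    with an identity at one source records transfer matrices. *)
Definition gate_eqs (F : fieldType) (d m : nat)
    (C : forall i : M, 'I_(size (inp i)) -> 'M[F]_d) (V : M -> 'M[F]_(d, m)) :=
  forall i, inp i != [::] -> V i = \sum_k C i k *m V (wire k).

Lemma circuit_is_source_in i : is_source N (enum_rank (inl i)) = (inp i == [::]).
Proof.
apply/forallP/eqP => [noin | ini e].
  case E: (inp i) => [//|j s]; exfalso.
  have lt0 : (0 < size (inp i))%N by rewrite E.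
  have /= := noin (enum_rank (clink (Ordinal lt0))).
  by rewrite enum_rankK eqxx.
rewrite /= (inj_eq enum_rank_inj).
case: (enum_val e) => [//|[j k]] /=; apply/eqP => -[ji].
by move: k; rewrite ji ini => -[].
Qed.

Lemma circuit_is_source_out i : is_source N (enum_rank (inr i)) = false.
Proof.
apply/forallP => /(_ (enum_rank (inl i))) /=.
by rewrite enum_rankK eqxx.
Qed.

Lemma circuit_is_terminal_in i : is_terminal N (enum_rank (inl i)) = false.
Proof.
apply/forallP => /(_ (enum_rank (inl i))) /=.
by rewrite enum_rankK eqxx.
Qed.

Lemma circuit_is_terminal_out i :
  (forall j, i \notin inp j) -> is_terminal N (enum_rank (inr i)).
Proof.
move=> nouse; apply/forallP => e /=; rewrite (inj_eq enum_rank_inj).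
case: (enum_val e) => [//|[j k]] /=; apply/eqP => -[ji].
by have := nouse j; rewrite -ji mem_nth.
Qed.

Variable rk : M -> nat.
Hypothesis rkP : forall i j, j \in inp i -> (rk j < rk i)%N.
Hypothesis demP : forall t s,
  dem t s -> [/\ inp s = [::], inp t != [::] & forall j, t \notin inp j].

Lemma circuit_network_wf : network_wf N.
Proof.
split.
(* A bottleneck edge climbs from [2r] to [2r + 1]; a link climbs from an odd rank to a larger even
   one. *)
- exists (fun v => match enum_val v with inl i => (rk i).*2 | inr i => (rk i).*2.+1 end).
  move=> e /=; rewrite !enum_rankK; case: (enum_val e) => [i|[i k]] //=.
  by rewrite ltn_Sdouble rkP // mem_nth.
- move=> v; rewrite -(enum_valK v); case: (enum_val v) => i.
    by rewrite circuit_is_terminal_in andbF.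
  by rewrite circuit_is_source_out.
- move=> t s; rewrite -(enum_valK t) -(enum_valK s) /= !enum_rankK.
  case: (enum_val t) (enum_val s) => [//|t'] [s' /= /demP [s0 _ nouse]|//].
  by rewrite circuit_is_source_in s0 circuit_is_terminal_out.
Qed.

Lemma sum_head_in (W : nmodType) (G : 'I_(ne N) -> W) i :
  \sum_(e : 'I_(ne N) | Defs.head e == enum_rank (inl i)) G e =
  \sum_(k < size (inp i)) G (enum_rank (clink k) : 'I_(ne N)).
Proof.
rewrite (reindex (@enum_rank cedge)) /=; last exact/onW_bij/enum_rank_bij.
rewrite big_sumType /= big1 ?add0r => [|j]; last first.
  by rewrite enum_rankK (inj_eq enum_rank_inj).
rewrite (eq_bigl (fun p => (tag p == i) && true)) => [|p]; last first.
  by rewrite enum_rankK (inj_eq enum_rank_inj) andbT.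
rewrite (eq_bigr (fun p => G (enum_rank (clink (tagged p))))); last first.
  by move=> [].
by rewrite -(@sig_big_dep _ _ _ _ (fun i => 'I_(size (inp i))) (pred1 i) (fun _ => predT)
  (fun i k => G (enum_rank (clink k)))) big_pred1_eq.
Qed.

Lemma sum_head_out (W : nmodType) (G : 'I_(ne N) -> W) i :
  \sum_(e : 'I_(ne N) | Defs.head e == enum_rank (inr i)) G e =
  G (enum_rank (inl i)).
Proof.
rewrite (big_pred1 (enum_rank (inl i))) // => e /=.
rewrite -[e in RHS]enum_valK !(inj_eq enum_rank_inj).
by case: (enum_val e).
Qed.

Variables (F : fieldType) (d : nat).

Lemma circuit_solvable (C : forall i : M, 'I_(size (inp i)) -> 'M[F]_d) :
    (forall V : M -> 'cV_d, gate_eqs C V -> forall t s, dem t s -> V t = V s) ->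
  vlnc_solvable N F d.
Proof.
move=> solC.
(* The coefficients [C] act where a link enters a bottleneck; sources, links and terminals only
   copy. *)
pose K (e' e : 'I_(ne N)) : 'M[F]_d :=
  match enum_val e, enum_val e' with inl i, inr p => C _ (tagged p) | _, _ => 1%:M end.
exists (fun _ => 1%:M), K, (fun _ _ _ => 1%:M) => x y xy t s.
pose V i := y (enum_rank (inl i)).
have gates : gate_eqs C V.
  move=> i ni; have := xy (enum_rank (inl i)).
  rewrite /= !enum_rankK circuit_is_source_in (negPf ni) => yi.
  rewrite /V yi sum_head_in; apply: eq_bigr => k _.
  rewrite /K !enum_rankK /=; congr (_ *m _).
  have := xy (enum_rank (clink k)).
  by rewrite /= !enum_rankK circuit_is_source_out sum_head_out /K !enum_rankK mul1mx.
rewrite -(enum_valK t) -(enum_valK s) /= !enum_rankK.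
case: (enum_val t) (enum_val s) => [//|t'] [s'|//] /= ts.
rewrite sum_head_out mul1mx -/(V t') (solC V gates t' s' ts).
have := xy (enum_rank (inl s')); rewrite /= !enum_rankK circuit_is_source_in.
by have [-> _ _] := demP ts; rewrite mul1mx.
Qed.

(** A code on the network collapses to circuit coefficients by multiplying the matrices met along
    source encoding, link and bottleneck. Decoding works column by column, so [V] may be a
    matrix. *)
Lemma solvable_circuit : vlnc_solvable N F d ->
  exists (C : forall i : M, 'I_(size (inp i)) -> 'M[F]_d) (B : M -> M -> 'M[F]_d),
    forall m (V : M -> 'M_(d, m)), gate_eqs C V ->
    forall t s, dem t s -> B t s *m V t = V s.
Proof.
move=> [A [K [Dec sol]]].
pose bot i : 'I_(ne N) := enum_rank (inl i).
pose lnk i (k : 'I_(size (inp i))) : 'I_(ne N) := enum_rank (clink k).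
(* Source encodings are moved into the gates that read the source, so that [V] at a source is the
   raw message. *)
pose A' i := if inp i == [::] then A (bot i) else 1%:M.
exists (fun i k => K (lnk i k) (bot i) *m (K (bot (wire k)) (lnk i k) *m A' (wire k))).
exists (fun t s => Dec (enum_rank (inr t)) (enum_rank (inl s)) (bot t)) => m V gates t s ts.
apply/matrixP => r c; suff /matrixP/(_ r 0) :
    Dec (enum_rank (inr t)) (enum_rank (inl s)) (bot t) *m col c (V t) = col c (V s).
  by rewrite colE mulmxA -colE !mxE.
pose x (v : 'I_(nn N)) := match enum_val v with inl i => col c (V i) | inr _ => 0 end.
pose y (e : 'I_(ne N)) := match enum_val e with inl i => A' i *m col c (V i)
  | inr p => let j := wire (tagged p) in K (bot j) e *m (A' j *m col c (V j)) end.
have yb i : y (bot i) = A' i *m col c (V i) by rewrite /y enum_rankK.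
have xy : edge_eqs A K x y.
  move=> e; rewrite -(enum_valK e) /= !enum_rankK.
  case: (enum_val e) => [i|[i k]] /=.
    rewrite circuit_is_source_in yb /A'; have [_|ni] := eqVneq (inp i) [::].
      by rewrite /x enum_rankK.
    rewrite mul1mx gates // sum_head_in colE mulmx_suml; apply: eq_bigr => k _.
    by rewrite /y enum_rankK /= !colE !mulmxA.
  rewrite circuit_is_source_out sum_head_out yb.
  by rewrite {1}/y enum_rankK.
have [_ nt _] := demP ts.
have := sol x y xy (enum_rank (inr t)) (enum_rank (inl s)).
rewrite /= !enum_rankK /= sum_head_out => /(_ ts).
by rewrite yb /A' (negPf nt) mul1mx /x enum_rankK.
Qed.

(** By acyclicity, iterating the equations more than [rk i] times fixes the value at [i]. *)
Lemma circuit_values m (C : forall i : M, 'I_(size (inp i)) -> 'M[F]_d) (x : M -> 'M[F]_(d, m)) :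
  exists V : M -> 'M[F]_(d, m), gate_eqs C V /\ forall s, inp s = [::] -> V s = x s.
Proof.
pose step (V : M -> 'M[F]_(d, m)) i :=
  if inp i == [::] then x i else \sum_k C i k *m V (wire k).
pose val n := iter n step x.
have stable n : forall i n', (rk i < n)%N -> (rk i < n')%N -> val n i = val n' i.
  elim: n => [//|n IH] i [//|n'] ltn ltn' /=.
  rewrite /step; case: eqP => // _; apply: eq_bigr => k _.
  have rkk : (rk (wire k) < rk i)%N by rewrite rkP // mem_nth.
  by congr (_ *m _); apply: IH; apply: (leq_trans rkk).
have valS n i : val n.+1 i = if inp i == [::] then x i else \sum_k C i k *m val n (wire k).
  by [].
exists (fun i => val (rk i).+1 i); split=> [i ni|s s0]; last first.
  by rewrite valS (introT eqP s0).
rewrite valS (negPf ni); apply: eq_bigr => k _; congr (_ *m _).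
by apply: stable; rewrite ?rkP ?mem_nth.
Qed.

End CircuitNetwork.

(** * The commutator circuit *)

Inductive gate := Sbc | Sab | Sac | Dac | X1 | Y1 | X2 | Y2 | Z1 | Z2 | P | U1 | U2 | U3.

Definition gates := [:: Sbc; Sab; Sac; Dac; X1; Y1; X2; Y2; Z1; Z2; P; U1; U2; U3].

Definition gate_index (g : gate) : nat :=
  match g with
  | Sbc => 0 | Sab => 1 | Sac => 2 | Dac => 3 | X1 => 4 | Y1 => 5 | X2 => 6
  | Y2 => 7 | Z1 => 8 | Z2 => 9 | P => 10 | U1 => 11 | U2 => 12 | U3 => 13
  end.

Lemma gate_indexK : pcancel gate_index (onth gates).
Proof. by case. Qed.

HB.instance Definition _ := Countable.copy gate (pcan_type gate_indexK).

Lemma gates_enum : Finite.axiom gates.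
Proof. by case. Qed.

HB.instance Definition _ := isFinite.Build gate gates_enum.

Definition message := ('I_3 + gate + gate)%type.

Definition src (s : 'I_3) : message := inl (inl s).
(* [out g] is the message computed by the gate [g]; the message [decoder g] goes to a
   terminal that demands the source [decoded g]. [decoder P] is the one exception to
   [decoder g] testing [g]: it decodes a from U1, U2, U3. *)
Definition out (g : gate) : message := inl (inr g).
Definition decoder (g : gate) : message := inr g.
Local Notation a := (@Ordinal 3 0 isT).
Local Notation b := (@Ordinal 3 1 isT).
Local Notation c := (@Ordinal 3 2 isT).

Definition gate_inputs (g : gate) : seq message :=
  match g with
  | Sbc => [:: src b; src c]
  | Sab => [:: src a; src b]
  | Sac => [:: src a; src c]
  | Dac => [:: out Sab; out Sbc]
  | X1 => [:: src a; src b]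
  | Y1 => [:: src b; src c]
  | X2 => [:: out X1; out Sbc]
  | Y2 => [:: out Y1; out Dac]
  | Z1 => [:: out X1; out Y1]
  | Z2 => [:: out Y2; out X2]
  | P => [:: out Z1; out Z2]
  | U1 => [:: out Sab; out Sbc]
  | U2 => [:: out Sac; out Sbc]
  | U3 => [:: out P; out Dac]
  end.

(** Pairing a gate with [P] forces two of its coefficients to agree. Pairing it with a source makes
    the decoded coefficient invertible and the coefficient of the third source zero. *)
Definition decoder_inputs (g : gate) : seq message :=
  match g with
  | Sbc => [:: out Sbc; out P]
  | Sab => [:: out Sab; out P]
  | Sac => [:: out Sac; out P]
  | Dac => [:: out Dac; src c]
  | X1 => [:: out X1; src b]
  | Y1 => [:: out Y1; src c]
  | X2 => [:: out X2; src c]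
  | Y2 => [:: out Y2; src a]
  | Z1 => [:: out Z1; src c]
  | Z2 => [:: out Z2; src c]
  | P => [:: out U1; out U2; out U3]
  | U1 => [:: out U1; out P]
  | U2 => [:: out U2; out P]
  | U3 => [:: out U3; src a]
  end.

Definition decoded (g : gate) : 'I_3 :=
  match g with
  | Sbc => a | Sab => c | Sac => b | Dac => a | X1 => a | Y1 => b | X2 => a
  | Y2 => b | Z1 => a | Z2 => b | P => a | U1 => b | U2 => c | U3 => b
  end.

Definition inputs (i : message) : seq message :=
  match i with
  | inl (inl _) => [::]
  | inl (inr g) => gate_inputs g
  | inr g => decoder_inputs g
  end.

Definition demands (t s : message) : bool :=
  if t is inr g then s == src (decoded g) else false.

Definition gate_rank (g : gate) : nat :=
  match g with
  | Sbc | Sab | Sac | X1 | Y1 => 1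
  | Dac | X2 | Z1 | U1 | U2 => 2
  | Y2 => 3
  | Z2 => 4
  | P => 5
  | U3 => 6
  end.

Definition rank (i : message) : nat :=
  match i with inl (inl _) => 0 | inl (inr g) => gate_rank g | inr _ => 7 end.

Lemma rank_inputs i j : j \in inputs i -> (rank j < rank i)%N.
Proof.
suff /allP : all (fun j => rank j < rank i)%N (inputs i) by apply.
by move: i => [[s|[]]|[]].
Qed.

Lemma demands_src t s :
  demands t s -> [/\ inputs s = [::], inputs t != [::] & forall j, t \notin inputs j].
Proof.
move: t => [//|g] /= /eqP->; split=> //; first by case: g.
by move=> [[?|[]]|[]]; rewrite /= ?inE.
Qed.

Definition commutator_network := circuit_network inputs demands.

(** * Sufficiency: a code when d = 0 and 5 is nonzero in F *)

(* [X] and [Y] are the matrices of multiplication by t and of d/dt on F[t]/(t^d). *)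
Lemma weyl_pair (F : fieldType) (d : nat) : d%:R = 0 :> F ->
  exists X Y : 'M[F]_d, Y *m X = 1%:M + X *m Y.
Proof.
move=> d0.
exists (\matrix_(i, j) (i == j.+1 :> nat)%:R), (\matrix_(i, j) ((i.+1 == j)%:R *+ j)).
apply/matrixP => i k; rewrite !mxE.
transitivity ((i == k)%:R *+ k.+1 : F).
  have [lt|ge] := ltnP k.+1 d.
    rewrite (bigD1 (Ordinal lt)) //= big1 => [|j /negPf jk]; rewrite !mxE /=.
      by rewrite eqxx mulr1 addr0 eqSS.
    by move: jk; rewrite -val_eqE /= => ->; rewrite mulr0.
  (* In the last column multiplication by t overflows and gives 0, which agrees with the expected
     entry [d] because d = 0 in F. *)
  have -> : k.+1 = d by apply/eqP; rewrite eqn_leq ge ltn_ord.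
  rewrite -mulr_natr d0 mulr0 big1 // => j _; rewrite !mxE.
  have /negPf -> : (j != k.+1 :> nat) by rewrite neq_ltn (leq_trans (ltn_ord j) ge).
  by rewrite mulr0.
(* Splitting k + 1 as 1 + k leaves the claim that [X *m Y] is diagonal with entries k. *)
rewrite mulrS; congr (_ + _).
case: i => [[|i] lti].
  rewrite big1 => [|j _]; last by rewrite !mxE mul0r.
  by case: k => [[|k] ltk]; rewrite // mul0rn.
rewrite (bigD1 (Ordinal (ltnW lti))) //= big1 => [|j /negPf ji]; rewrite !mxE /=.
  by rewrite eqxx mul1r addr0 -val_eqE.
by move: ji; rewrite -val_eqE /= eqSS eq_sym => ->; rewrite mul0r.
Qed.

Lemma commutator_network_solvable (F : fieldType) (d : nat) :
  d%:R = 0 :> F -> 5%:R != 0 :> F -> vlnc_solvable commutator_network F d.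
Proof.
move=> d0 five; have [X [Y YX]] := weyl_pair d0.
pose I : 'M[F]_d := 1%:M.
pose cf (i : message) : seq 'M[F]_d :=
  match i with
  | inl (inl _) => [::]
  | inl (inr g) => match g with
    | Sbc | Sab | Sac | P | U1 | U2 | U3 => [:: I; I]
    | Dac => [:: I; - I]
    | X1 => [:: I; X]
    | Y1 => [:: I; Y]
    | X2 | Z1 => [:: I; - X]
    | Y2 => [:: I; Y]
    | Z2 => [:: I; - Y]
    end
  | inr g => match g with
    | Sbc | Sab | Sac => [:: - I; I]
    | Dac => [:: I; I]
    | X1 => [:: I; - X]
    | Y1 => [:: I; - Y]
    | X2 => [:: I; X]
    | Y2 => [:: I; - Y]
    | Z1 => [:: I; X *m Y]
    | Z2 => [:: I; - (Y *m X)]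
    (* These solve 5a = - 2 U1 + U2 + 3 U3. *)
    | P => [:: (- 2%:R / 5%:R)%:M; (5%:R^-1)%:M; (3%:R / 5%:R)%:M]
    | U1 | U2 => [:: I; - I]
    | U3 => [:: I; (- 2%:R)%:M]
    end
  end.
apply: (circuit_solvable demands_src (C := fun i k => nth 0 (cf i) k)).
move=> V eqs t s.
have G g : V (out g) = \sum_(k < size (gate_inputs g)) nth 0 (cf (out g)) k *m
    V (nth (out g) (gate_inputs g) k).
  by rewrite (eqs (out g)) //; case: g.
have T g : V (decoder g) = \sum_(k < size (decoder_inputs g)) nth 0 (cf (decoder g)) k *m
    V (nth (decoder g) (decoder_inputs g) k).
  by rewrite (eqs (decoder g)) //; case: g.
set va := V (src a); set vb := V (src b); set vc := V (src c).
have g2 := (big_ord_recl, big_ord0, addr0).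
have GSbc : V (out Sbc) = vb + vc by rewrite G !g2 /= !mul1mx.
have GSab : V (out Sab) = va + vb by rewrite G !g2 /= !mul1mx.
have GSac : V (out Sac) = va + vc by rewrite G !g2 /= !mul1mx.
have GDac : V (out Dac) = va - vc.
  by rewrite G !g2 /= GSab GSbc mulNmx !mul1mx opprD addrA addrK.
have GX1 : V (out X1) = va + X *m vb by rewrite G !g2 /= !mul1mx.
have GY1 : V (out Y1) = vb + Y *m vc by rewrite G !g2 /= !mul1mx.
have GX2 : V (out X2) = va - X *m vc.
  by rewrite G !g2 /= GX1 GSbc mulNmx !mul1mx mulmxDr opprD addrA addrK.
have GY2 : V (out Y2) = vb + Y *m va.
  by rewrite G !g2 /= GY1 GDac !mul1mx mulmxBr addrACA subrr addr0.
have GZ1 : V (out Z1) = va - X *m Y *m vc.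
  by rewrite G !g2 /= GX1 GY1 mulNmx !mul1mx mulmxDr mulmxA opprD addrA addrK.
have GZ2 : V (out Z2) = vb + Y *m X *m vc.
  by rewrite G !g2 /= GY2 GX2 mulNmx !mul1mx mulmxBr mulmxA opprB addrACA subrr addr0.
(* The coefficient of c is YX - XY; only here is the commutation relation needed. *)
have GP : V (out P) = va + vb + vc.
  rewrite G !g2 /= GZ1 GZ2 !mul1mx YX mulmxDl mul1mx.
  by apply/matrixP => i j; rewrite !mxE; ring.
have GU1 : V (out U1) = va + 2%:R *: vb + vc.
  rewrite G !g2 /= GSab GSbc !mul1mx.
  by apply/matrixP => i j; rewrite !mxE; ring.
have GU2 : V (out U2) = va + vb + 2%:R *: vc.
  rewrite G !g2 /= GSac GSbc !mul1mx.
  by apply/matrixP => i j; rewrite !mxE; ring.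
have GU3 : V (out U3) = 2%:R *: va + vb.
  rewrite G !g2 /= GP GDac !mul1mx.
  by apply/matrixP => i j; rewrite !mxE; ring.
case: t => [//|g] /= /eqP ->; rewrite T.
case: g; rewrite !g2 /= ?(GSbc, GSab, GSac, GDac, GX1, GY1, GX2, GY2, GZ1, GZ2, GP, GU1, GU2, GU3).
all: rewrite ?mulNmx ?mul1mx ?mul_scalar_mx -/va -/vb -/vc.
all: apply/matrixP => i j; rewrite !mxE; try ring.
by field.
Qed.

(** * Necessity: the decoders determine the coefficients *)

Section Necessity.
Variables (F : fieldType) (n : nat).
Local Notation R := 'M[F]_n.+1.

(** Factors of an invertible square matrix over a field are invertible, so decoding equations yield
    units although [R] need not be commutative. *)
Lemma unitrM_mx (x y : R) :
  (x * y \is a GRing.unit) = (x \is a GRing.unit) && (y \is a GRing.unit).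
Proof. exact: unitmx_mul. Qed.

Lemma unit_factors (x y z : R) : z \is a GRing.unit -> x * y = z ->
  x \is a GRing.unit /\ y \is a GRing.unit.
Proof. by move=> uz xyz; apply/andP; rewrite -unitrM_mx xyz. Qed.

Lemma unit_mul_eq0 (x y : R) : x \is a GRing.unit -> x * y = 0 -> y = 0.
Proof. by move=> ux xy0; apply: (mulrI ux); rewrite xy0 mulr0. Qed.

(** Here [x] is the decoder's weight on a sum gate, [y] and [z] are the gate's two coefficients, and
    [l] comes from [P]. As a left factor of the unit [- l], [x] cancels. *)
Lemma balanced_pair (x y z l : R) : l \is a GRing.unit ->
  x * y + l = 0 -> x * z + l = 0 -> y = z.
Proof.
move=> ul /eqP; rewrite addr_eq0 => /eqP xy /eqP; rewrite addr_eq0 => /eqP xz.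
have ul' : - l \is a GRing.unit by rewrite unitrN.
have [ux _] := unit_factors ul' xy.
by apply: (mulrI ux); rewrite xy xz.
Qed.

Variables (L : 'I_3 -> R) (W : 'I_3 -> message -> R).
Hypothesis unitL : forall s, L s \is a GRing.unit.
(* [W s i] is the coefficient of source [s] in message [i], after a change of coordinates
   making all coefficients of [P] equal to 1. *)
Hypothesis W_src : forall s s', W s (src s') = if s == s' then L s else 0.
Hypothesis W_P : forall s, W s (out P) = 1.
Hypothesis W_gate : forall g, exists C : nat -> R, forall s,
  W s (out g) = \sum_(k < size (gate_inputs g)) C k * W s (nth (out g) (gate_inputs g) k).
Hypothesis W_dec : forall g, exists D : nat -> R, forall s,
  \sum_(k < size (decoder_inputs g)) D k * W s (nth (out g) (decoder_inputs g) k) =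
  W s (src (decoded g)).

Lemma gate2 g i j : gate_inputs g = [:: i; j] ->
  exists x y, forall s, W s (out g) = x * W s i + y * W s j.
Proof.
move=> gij; have [C WC] := W_gate g; exists (C 0), (C 1) => s.
by rewrite WC gij !big_ord_recl big_ord0 addr0.
Qed.

Lemma dec2 g i j : decoder_inputs g = [:: i; j] ->
  exists x y, forall s, x * W s i + y * W s j = W s (src (decoded g)).
Proof.
move=> gij; have [D WD] := W_dec g; exists (D 0), (D 1) => s.
by rewrite -WD gij !big_ord_recl big_ord0 addr0.
Qed.

Local Ltac src_simp := rewrite ?(W_P, W_src) /= ?(mulr0, mulr1, addr0, add0r).

Lemma W_Sbc : exists q,
  [/\ W a (out Sbc) = 0, W b (out Sbc) = q & W c (out Sbc) = q].
Proof.
have [x [y WG]] := @gate2 Sbc _ _ erefl.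
have [D [E WD]] := @dec2 Sbc _ _ erefl.
have := WD a; have := WD b; have := WD c; rewrite !WG; src_simp => c0 b0 e0.
rewrite e0 in b0 c0.
by exists (x * L b); split=> //; apply/esym/(balanced_pair (unitL a) b0 c0).
Qed.

Lemma W_Sab : exists q,
  [/\ W a (out Sab) = q, W b (out Sab) = q & W c (out Sab) = 0].
Proof.
have [x [y WG]] := @gate2 Sab _ _ erefl.
have [D [E WD]] := @dec2 Sab _ _ erefl.
have := WD c; have := WD a; have := WD b; rewrite !WG; src_simp => c0 b0 e0.
rewrite e0 in b0 c0.
by exists (x * L a); split=> //; apply/esym/(balanced_pair (unitL c) b0 c0).
Qed.

Lemma W_Sac : exists q,
  [/\ W a (out Sac) = q, W b (out Sac) = 0 & W c (out Sac) = q].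
Proof.
have [x [y WG]] := @gate2 Sac _ _ erefl.
have [D [E WD]] := @dec2 Sac _ _ erefl.
have := WD b; have := WD a; have := WD c; rewrite !WG; src_simp => c0 b0 e0.
rewrite e0 in b0 c0.
by exists (x * L a); split=> //; apply/esym/(balanced_pair (unitL b) b0 c0).
Qed.

(** Decoding a with the help of c alone forces the b-parts of [Sab] and [Sbc] to cancel. *)
Lemma W_Dac : exists m,
  [/\ W a (out Dac) = m, W b (out Dac) = 0 & W c (out Dac) = - m].
Proof.
have [q [Sbca Sbcb Sbcc]] := W_Sbc; have [q' [Saba Sabb Sabc]] := W_Sab.
have [x [y WG]] := @gate2 Dac _ _ erefl.
have [D [E WD]] := @dec2 Dac _ _ erefl.
have := WD a; have := WD b; rewrite !WG Sbca Sbcb Sbcc Saba Sabb Sabc; src_simp => b0 a0.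
have [uD _] := unit_factors (unitL a) a0.
have /eqP := unit_mul_eq0 uD b0; rewrite addrC addr_eq0 => /eqP yx.
by exists (x * q'); split=> //; rewrite yx ?addNr.
Qed.

Lemma W_X1Y1 : exists X Y,
  (exists x,
    [/\ W a (out X1) = x, W b (out X1) = x * X & W c (out X1) = 0]) /\
  (exists y,
    [/\ W a (out Y1) = 0, W b (out Y1) = y & W c (out Y1) = y * Y]).
Proof.
have [x [x' WX]] := @gate2 X1 _ _ erefl; have [D [E WD]] := @dec2 X1 _ _ erefl.
have [y [y' WY]] := @gate2 Y1 _ _ erefl; have [D' [E' WD']] := @dec2 Y1 _ _ erefl.
have := WD a; have := WD' b; rewrite !WX !WY; src_simp => b0 a0.
have [_ ux] := unit_factors (unitL a) a0; have [_ uy] := unit_factors (unitL b) b0.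
exists ((x * L a)^-1 * (x' * L b)), ((y * L b)^-1 * (y' * L c)); split.
  by exists (x * L a); split; src_simp => //; rewrite mulVKr.
by exists (y * L b); split; src_simp => //; rewrite mulVKr.
Qed.

Lemma W_commutator : exists X Y : R, Y * X - X * Y = 1.
Proof.
have [q [Sbca Sbcb Sbcc]] := W_Sbc; have [m [Daca Dacb Dacc]] := W_Dac.
have [X [Y [[x [X1a X1b X1c]] [y [Y1a Y1b Y1c]]]]] := W_X1Y1.
exists X, Y.
(* For each of [X2], [Y2], [Z1], [Z2], the vanishing third coefficient expresses the contribution of
   the second input through the first, and so fixes the remaining coefficient. *)
have [u [X2a X2b X2c]] : exists u,
    [/\ W a (out X2) = u, W b (out X2) = 0 & W c (out X2) = - (u * X)].
  have [k [l WG]] := @gate2 X2 _ _ erefl; have [D [E WD]] := @dec2 X2 _ _ erefl.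
  have := WD a; have := WD b.
  rewrite !WG X1a X1b X1c Sbca Sbcb Sbcc; src_simp => b0 a0.
  have [uD _] := unit_factors (unitL a) a0.
  have e0 := unit_mul_eq0 uD b0; exists (k * x); split=> //.
  by apply/eqP; rewrite -addr_eq0 addrC -mulrA; apply/eqP.
have [v [Y2a Y2b Y2c]] : exists v,
    [/\ W a (out Y2) = v * Y, W b (out Y2) = v & W c (out Y2) = 0].
  have [k [l WG]] := @gate2 Y2 _ _ erefl; have [D [E WD]] := @dec2 Y2 _ _ erefl.
  have := WD b; have := WD c.
  rewrite !WG Y1a Y1b Y1c Daca Dacb Dacc; src_simp => c0 b0.
  have [uD _] := unit_factors (unitL b) b0.
  have e0 := unit_mul_eq0 uD c0; exists (k * y); split=> //.
  by apply/esym/eqP; rewrite -subr_eq0 -mulrA -mulrN; apply/eqP.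
have [z [Z1a Z1b Z1c]] : exists z,
    [/\ W a (out Z1) = z, W b (out Z1) = 0 & W c (out Z1) = - (z * X * Y)].
  have [k [l WG]] := @gate2 Z1 _ _ erefl; have [D [E WD]] := @dec2 Z1 _ _ erefl.
  have := WD a; have := WD b.
  rewrite !WG X1a X1b X1c Y1a Y1b Y1c; src_simp => b0 a0.
  have [uD _] := unit_factors (unitL a) a0.
  have e0 := unit_mul_eq0 uD b0; exists (k * x); split=> //.
  apply/eqP; rewrite -addr_eq0 addrC -[k * x * X]mulrA [l * _]mulrA -mulrDl e0.
  by rewrite mul0r.
have [w [Z2a Z2b Z2c]] : exists w,
    [/\ W a (out Z2) = 0, W b (out Z2) = w & W c (out Z2) = w * Y * X].
  have [k [l WG]] := @gate2 Z2 _ _ erefl; have [D [E WD]] := @dec2 Z2 _ _ erefl.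
  have := WD b; have := WD a.
  rewrite !WG Y2a Y2b Y2c X2a X2b X2c; src_simp => a0 b0.
  have [uD _] := unit_factors (unitL b) b0.
  have e0 := unit_mul_eq0 uD a0; exists (k * v); split=> //.
  apply/esym/eqP; rewrite -subr_eq0 mulrN opprK -[k * v * Y]mulrA [l * _]mulrA.
  by rewrite -mulrDl e0 mul0r.
(* The a- and b-coefficients of [P] give k z = l w = 1; its c-coefficient then reads YX - XY = 1. *)
have [k [l WG]] := @gate2 P _ _ erefl.
have := WG a; have := WG b; have := WG c.
rewrite !W_P Z1a Z1b Z1c Z2a Z2b Z2c !mulr0 addr0 add0r => c1 b1 a1.
by rewrite c1 mulrN !mulrA -a1 -b1 !mul1r addrC.
Qed.

Lemma W_five : 5%:R != 0 :> F.
Proof.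
have [q [Sbca Sbcb Sbcc]] := W_Sbc; have [m [Daca Dacb Dacc]] := W_Dac.
have [q1 [Saba Sabb Sabc]] := W_Sab; have [q2 [Saca Sacb Sacc]] := W_Sac.
have [u [U1a U1b U1c]] : exists u,
    [/\ W a (out U1) = u, W b (out U1) = u + u & W c (out U1) = u].
  have [k [l WG]] := @gate2 U1 _ _ erefl; have [D [E WD]] := @dec2 U1 _ _ erefl.
  have := WD a; have := WD b; have := WD c.
  rewrite !WG Saba Sabb Sabc Sbca Sbcb Sbcc; src_simp => c0 b0 a0.
  (* Subtracting the a-equation from the b-equation shows that [D] is invertible. *)
  have lb : D * (l * q) = L b.
    by rewrite -b0 mulrDr -addrA [_ * (l * q) + E]addrC addrA a0 add0r.
  have [uD _] := unit_factors (unitL b) lb.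
  have kl : k * q1 = l * q by apply: (mulrI uD); apply: (addIr E); rewrite a0 c0.
  by exists (l * q); rewrite kl.
have [v [U2a U2b U2c]] : exists v,
    [/\ W a (out U2) = v, W b (out U2) = v & W c (out U2) = v + v].
  have [k [l WG]] := @gate2 U2 _ _ erefl; have [D [E WD]] := @dec2 U2 _ _ erefl.
  have := WD a; have := WD b; have := WD c.
  rewrite !WG Saca Sacb Sacc Sbca Sbcb Sbcc; src_simp => c0 b0 a0.
  have lb : D * (l * q) = L c.
    by rewrite -c0 mulrDr -addrA [_ * (l * q) + E]addrC addrA a0 add0r.
  have [uD _] := unit_factors (unitL c) lb.
  have kl : k * q2 = l * q by apply: (mulrI uD); apply: (addIr E); rewrite a0 b0.
  by exists (l * q); rewrite kl.
have [w [U3a U3b U3c]] : exists w,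
    [/\ W a (out U3) = w + w, W b (out U3) = w & W c (out U3) = 0].
  have [k [l WG]] := @gate2 U3 _ _ erefl; have [D [E WD]] := @dec2 U3 _ _ erefl.
  have := WD b; have := WD c.
  rewrite !WG Daca Dacb Dacc; src_simp => c0 b0.
  have [uD _] := unit_factors (unitL b) b0.
  have e0 := unit_mul_eq0 uD c0; exists k; split=> //.
  by congr (_ + _); apply/esym/eqP; rewrite -subr_eq0 -mulrN; apply/eqP.
have [D WD] := W_dec P.
have := WD a; have := WD b; have := WD c.
rewrite !big_ord_recl !big_ord0 /= U1a U1b U1c U2a U2b U2c U3a U3b U3c; src_simp.
rewrite !mulrDr.
(* With the decoder weights absorbed, what remains is a linear system with integer coefficients and
   determinant 5: e = - 2f, g = 3f, hence [L a] = 5f. *)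
move: (D _ * u) (D _ * v) (D _ * w) => e f g c0 b0 a0.
have La5 : L a = 5%:R *: f.
  have ef : e = - (f + f) by apply/eqP; rewrite -addr_eq0 c0.
  move: b0; rewrite ef => b0.
  have gf : g = f + f + f.
    by rewrite -[RHS]addr0 -b0; apply/matrixP => i j; rewrite !mxE; ring.
  by rewrite -a0 ef gf; apply/matrixP => i j; rewrite !mxE; ring.
by apply: contraTneq (unitL a) => five; rewrite La5 five scale0r unitr0.
Qed.

End Necessity.

Lemma commutator_network_char (F : fieldType) (n : nat) :
  vlnc_solvable commutator_network F n.+1 -> n.+1%:R = 0 :> F /\ 5%:R != 0 :> F.
Proof.
move=> /(solvable_circuit demands_src) [C [B sol]].
(* An identity at [s] and zero at the other sources make [V] list the coefficients of [s]. *)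
have valP (s : 'I_3) : exists V : message -> 'M[F]_n.+1,
    gate_eqs C V /\ forall s', V (src s') = if s == s' then 1 else 0.
  have [V [gV sV]] := circuit_values rank_inputs C
    (fun i => if i == src s then 1 else 0 : 'M[F]_n.+1).
  by exists V; split=> // s'; rewrite sV // eq_sym.
have [Va [gVa sVa]] := valP a; have [Vb [gVb sVb]] := valP b.
have [Vc [gVc sVc]] := valP c.
pose V (s : 'I_3) := nth Va [:: Va; Vb; Vc] s.
have gV s : gate_eqs C (V s) by case: s => [[|[|[|]]]].
have sV s s' : V s (src s') = if s == s' then 1 else 0.
  by case: s => [[|[|[|s]]] lts] //.
pose C' i (k : nat) := if insub k is Some k' then C i k' else 0.
have gate s g : V s (out g) = \sum_(k < size (gate_inputs g))
    C' (out g) k * V s (nth (out g) (gate_inputs g) k).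
  have -> := gV s (out g); last by case: g.
  by apply: eq_bigr => k _; rewrite /C' valK.
have decode s g : B (decoder g) (src (decoded g)) * (\sum_(k < size (decoder_inputs g))
    C' (decoder g) k * V s (nth (decoder g) (decoder_inputs g) k)) = V s (src (decoded g)).
  rewrite -(sol _ _ (gV s) (decoder g) _ (eqxx _)) -mulmxE; congr (_ *m _).
  have -> := gV s (decoder g); last by case: g.
  by apply: eq_bigr => k _; rewrite /C' valK.
(* Source [s] is decoded from [P] and the sum gate of the other two sources, which carries nothing
   from [s]. *)
have unitP s : V s (out P) \is a GRing.unit.
  have [g ds [z0 gP]] : exists2 g, decoded g = s &
      V s (out g) = 0 /\ decoder_inputs g = [:: out g; out P].
    case: s => [[|[|[|s]]] lts] //.
    - exists Sbc; first exact: val_inj.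
      by rewrite gate !big_ord_recl big_ord0 /= !sV /= !mulr0 !addr0.
    - exists Sac; first exact: val_inj.
      by rewrite gate !big_ord_recl big_ord0 /= !sV /= !mulr0 !addr0.
    - exists Sab; first exact: val_inj.
      by rewrite gate !big_ord_recl big_ord0 /= !sV /= !mulr0 !addr0.
  have := decode s g; rewrite gP ds sV eqxx !big_ord_recl big_ord0 /= z0.
  rewrite mulr0 add0r addr0 mulrA => e1.
  by have [] := unit_factors (unitr1 _) e1.
(* Gate and decoder matrices act on the left, so multiplying on the right by [L s] preserves their
   equations. *)
pose L s := (V s (out P))^-1; pose W s i := V s i * L s.
have unitL s : L s \is a GRing.unit by rewrite unitrV.
have W_src s s' : W s (src s') = if s == s' then L s else 0.
  by rewrite /W sV; case: eqP => _; rewrite ?mul1r ?mul0r.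
have W_P s : W s (out P) = 1 by rewrite /W mulrV.
have W_gate g : exists C : nat -> 'M[F]_n.+1, forall s,
    W s (out g) = \sum_(k < size (gate_inputs g)) C k * W s (nth (out g) (gate_inputs g) k).
  exists (C' (out g)) => s; rewrite {1}/W gate mulr_suml.
  by apply: eq_bigr => k _; rewrite mulrA.
have W_dec g : exists D : nat -> 'M[F]_n.+1, forall s,
    \sum_(k < size (decoder_inputs g)) D k * W s (nth (out g) (decoder_inputs g) k) =
    W s (src (decoded g)).
  exists (fun k => B (decoder g) (src (decoded g)) * C' (decoder g) k) => s.
  rewrite {2}/W -decode mulr_sumr mulr_suml; apply: eq_bigr => k _.
  by rewrite (set_nth_default (out g)) // !mulrA.
split; last exact: W_five unitL W_src W_P W_gate W_dec.
(* A commutator has trace 0, while the identity has trace [n.+1]. *)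
have [X [Y /(congr1 mxtrace)]] := W_commutator unitL W_src W_P W_gate W_dec.
by rewrite raddfB /= mxtrace_mulC subrr mxtrace1.
Qed.

Theorem theorem5 :
  exists N : network,
    [/\ network_wf N,
        (exists F : finFieldType, vlnc_solvable N F 2),
        (exists F : finFieldType, vlnc_solvable N F 3) &
        (forall F : finFieldType, ~ vlnc_solvable N F 5)].
Proof.
exists commutator_network; split.
- exact: circuit_network_wf rank_inputs demands_src.
- by exists 'F_2; apply: commutator_network_solvable; apply/eqP.
- by exists 'F_3; apply: commutator_network_solvable; apply/eqP.
- by move=> F /commutator_network_char [-> /eqP].
Qed.
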